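(* Consider a SISO parametric polynomial structured system given by $\mathcal K(s,\mathbf p)$, $\mathbf B(\mathbf p)$, $\mathbf C(\mathbf p)$, $\mathbf H_\xi(\mathbf p)$ ($\xi\in\{2,\dots,d\}$), $\mathbf N_\eta(\mathbf p)$ ($\eta\in\{1,\dots,d-1\}$), with parameter $\mathbf p\in\Omega\subset\mathbb R^q$. Let $\sigma_i$, $\mathbf p_i\in\Omega$ and $\mu_i$, $i\in\{1,\dots,\tilde r\}$, be interpolation points such that $\mathcal K(s,\mathbf p)$ is invertible for all $s\in\{\sigma_i,\mu_i: i=1,\dots,\tilde r\}$ and $\mathbf p\in\{\mathbf p_1,\dots,\mathbf p_{\tilde r}\}$. Write $\mathbf v_i=\mathcal K^{-1}(\sigma_i,\mathbf p_i)\mathbf B(\mathbf p_i)$ and $\mathbf w_i=\mathcal K^{-\top}(\mu_i,\mathbf p_i)\mathbf C(\mathbf p_i)^\top$, and define $$\mathcal V_{\mathrm L}=\sum_{i=1}^{\tilde r}\operatorname{range}(\mathbf v_i),\quad \mathcal V_{\mathrm N}=\sum_{\eta=1}^{d-1}\sum_{i=1}^{\tilde r}\operatorname{range}\big(\mathcal K^{-1}(\sigma_i,\mathbf p_i)\mathbf N_\eta(\mathbf p_i)\,\mathbf v_i^{\otimes\eta}\big),\quad \mathcal V_{\mathrm H}=\sum_{\xi=2}^{d}\sum_{i=1}^{\tilde r}\operatorname{range}\big(\mathcal K^{-1}(\sigma_i,\mathbf p_i)\mathbf H_\xi(\mathbf p_i)\,\mathbf v_i^{\otimes\xi}\big),$$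 $$\mathcal W_{\mathrm L}=\sum_{i=1}^{\tilde r}\operatorname{range}(\mathbf w_i),\quad \mathcal W_{\mathrm N}=\sum_{\eta=1}^{d-1}\sum_{i=1}^{\tilde r}\operatorname{range}\big(\mathcal K^{-\top}(\sigma_i,\mathbf p_i)(\mathbf N_\eta(\mathbf p_i))_{(2)}(\mathbf v_i^{\otimes(\eta-1)}\otimes\mathbf w_i)\big),$$ $$\mathcal W_{\mathrm H}=\sum_{\xi=2}^{d}\sum_{i=1}^{\tilde r}\operatorname{range}\big(\mathcal K^{-\top}(\sigma_i,\mathbf p_i)(\mathbf H_\xi(\mathbf p_i))_{(2)}(\mathbf v_i^{\otimes(\xi-1)}\otimes\mathbf w_i)\big).$$ Let $\mathbf V,\mathbf W$ be $n\times r$ matrices of full column rank with $\operatorname{range}(\mathbf V)=\mathcal V_{\mathrm L}+\mathcal V_{\mathrm N}+\mathcal V_{\mathrm H}$ and $\operatorname{range}(\mathbf W)=\mathcal W_{\mathrm L}+\mathcal W_{\mathrm N}+\mathcal W_{\mathrm H}$, and let the parametric reduced-order model be obtained by Petrov–Galerkin projection with $\mathbf V$ and $\mathbf W$. If the reduced matrix $\mathbf W^\top\mathcal K(s,\mathbf p)\mathbf V$ is nonsingular for $s\in\{\sigma_i,\mu_i\}$ and $\mathbf p\in\{\mathbf p_i\}$, $i\in\{1,\dots,\tilde r\}$, then for all $i\in\{1,\dots,\tilde r\}$, $\eta\in\{1,\dots,d-1\}$, $\xi\in\{2,\dots,d\}$: $$\mathbf F_{\mathrm L}(\sigma_i,\mathbf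 p_i)=\widehat{\mathbf F}_{\mathrm L}(\sigma_i,\mathbf p_i),\qquad \mathbf F_{\mathrm L}(\mu_i,\mathbf p_i)=\widehat{\mathbf F}_{\mathrm L}(\mu_i,\mathbf p_i),$$ $$\mathbf F^{(\eta)}_{\mathrm N}(\sigma_i,\dots,\sigma_i,\mathbf p_i)=\widehat{\mathbf F}^{(\eta)}_{\mathrm N}(\sigma_i,\dots,\sigma_i,\mathbf p_i),\qquad \mathbf F^{(\eta)}_{\mathrm N}(\sigma_i,\dots,\sigma_i,\mu_i,\mathbf p_i)=\widehat{\mathbf F}^{(\eta)}_{\mathrm N}(\sigma_i,\dots,\sigma_i,\mu_i,\mathbf p_i),$$ $$\mathbf F^{(\xi)}_{\mathrm H}(\sigma_i,\dots,\sigma_i,\mathbf p_i)=\widehat{\mathbf F}^{(\xi)}_{\mathrm H}(\sigma_i,\dots,\sigma_i,\mathbf p_i),\qquad \mathbf F^{(\xi)}_{\mathrm H}(\sigma_i,\dots,\sigma_i,\mu_i,\mathbf p_i)=\widehat{\mathbf F}^{(\xi)}_{\mathrm H}(\sigma_i,\dots,\sigma_i,\mu_i,\mathbf p_i).$$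
   Context: The (SISO) parametric polynomial structured system is $(\mathcal L(\mathbf p)\mathbf x)(t,\mathbf p)=\sum_{\xi=2}^d\mathbf H_\xi(\mathbf p)\,\mathbf x(t,\mathbf p)^{\otimes\xi}+\sum_{\eta=1}^{d-1}\mathbf N_\eta(\mathbf p)\big(\mathbf u(t)\otimes\mathbf x(t,\mathbf p)^{\otimes\eta}\big)+\mathbf B(\mathbf p)\mathbf u(t)$, $\mathbf y(t,\mathbf p)=\mathbf C(\mathbf p)\mathbf x(t,\mathbf p)$, with zero initial conditions, scalar input and output, $\mathbf x(t,\mathbf p)\in\mathbb R^n$, $\mathbf B(\mathbf p)\in\mathbb R^{n\times1}$, $\mathbf C(\mathbf p)\in\mathbb R^{1\times n}$, $\mathbf H_\xi(\mathbf p)\in\mathbb R^{n\times n^\xi}$, $\mathbf N_\eta(\mathbf p)\in\mathbb R^{n\times n^\eta}$. $\mathcal L(\mathbf p)$ is a linear operator with frequency-domain representation the $n\times n$ matrix-valued function $\mathcal K(s,\mathbf p)$, i.e. $\mathcal L(\mathbf p)\mathbf x$ has Laplace transform $\mathcal K(s,\mathbf p)\mathbf X(s)$. Multivariate transfer functions: $\mathbf F_{\mathrm L}(s_1,\mathbf p)=\mathbf C(\mathbf p)\mathcal K^{-1}(s_1,\mathbf p)\mathbf B(\mathbf p)$; $\mathbf F^{(\xi)}_{\mathrm H}(s_1,\dots,s_{\xi+1},\mathbf p)=\mathbf C(\mathbf p)\mathcal K^{-1}(s_{\xi+1},\mathbf p)\mathbf H_\xi(\mathbf p)\big(\mathcal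 K^{-1}(s_\xi,\mathbf p)\mathbf B(\mathbf p)\otimes\cdots\otimes\mathcal K^{-1}(s_1,\mathbf p)\mathbf B(\mathbf p)\big)$; $\mathbf F^{(\eta)}_{\mathrm N}(s_1,\dots,s_{\eta+1},\mathbf p)=\mathbf C(\mathbf p)\mathcal K^{-1}(s_{\eta+1},\mathbf p)\mathbf N_\eta(\mathbf p)\big(\mathcal K^{-1}(s_\eta,\mathbf p)\mathbf B(\mathbf p)\otimes\cdots\otimes\mathcal K^{-1}(s_1,\mathbf p)\mathbf B(\mathbf p)\big)$. Petrov–Galerkin projection: $\widehat{\mathcal K}(s,\mathbf p)=\mathbf W^\top\mathcal K(s,\mathbf p)\mathbf V$, $\widehat{\mathbf B}(\mathbf p)=\mathbf W^\top\mathbf B(\mathbf p)$, $\widehat{\mathbf C}(\mathbf p)=\mathbf C(\mathbf p)\mathbf V$, $\widehat{\mathbf H}_\xi(\mathbf p)=\mathbf W^\top\mathbf H_\xi(\mathbf p)\mathbf V^{\otimes\xi}$, $\widehat{\mathbf N}_\eta(\mathbf p)=\mathbf W^\top\mathbf N_\eta(\mathbf p)\mathbf V^{\otimes\eta}$; $\widehat{\mathbf F}_{\mathrm L},\widehat{\mathbf F}^{(\xi)}_{\mathrm H},\widehat{\mathbf F}^{(\eta)}_{\mathrm N}$ are given by the same formulas with hatted quantities. Frequency points may be complex, in which case $\mathbf V,\mathbf W$ and ranges are over $\mathbb C$; $^\top$ is the transpose without conjugation, $\mathcal K^{-\top}=(\mathcal K^{-1})^\top$. $\mathbf v^{\otimes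 k}$ is the $k$-fold Kronecker power (for $k=0$ the factor is absent). Matricization: for an $N$-way tensor $\boldsymbol{\mathcal X}\in\mathbb R^{n_1\times\cdots\times n_N}$, the mode-$m$ matricization has entries $\boldsymbol X_{(m)}(i_m,j)=\boldsymbol{\mathcal X}(i_1,\dots,i_N)$, $j=1+\sum_{k\ne m}(i_k-1)J_k$, $J_k=\prod_{z<k,\,z\ne m}n_z$. $\mathbf H_\xi(\mathbf p)$ (resp. $\mathbf N_\eta(\mathbf p)$) is the mode-1 matricization of a $(\xi+1)$-way (resp. $(\eta+1)$-way) tensor of size $n\times\cdots\times n$, and $(\mathbf H_\xi(\mathbf p))_{(2)}$, $(\mathbf N_\eta(\mathbf p))_{(2)}$ denote the mode-2 matricizations. Standing assumption: these tensors are symmetric, meaning that $\mathbf H_\xi(\mathbf p)(\mathbf q_1\otimes\cdots\otimes\mathbf q_\xi)$ and $\mathbf N_\eta(\mathbf p)(\mathbf q_1\otimes\cdots\otimes\mathbf q_\eta)$ are invariant under permutations of the vectors $\mathbf q_k$. *)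

(* Defs.v *)
From HB Require Import structures.
From mathcomp Require Import all_boot all_order all_fingroup all_algebra.
From mathcomp Require Import complex mxtens.
From mathcomp Require Import classical_sets reals.

Set Implicit Arguments.
Unset Strict Implicit.
Unset Printing Implicit Defensive.

Import GRing.Theory.
Local Open Scope ring_scope.
Local Open Scope complex_scope.

Section Kronecker.
Variables (F : pzRingType) (m n : nat).

(* Same recursion as ntensmx, which is the case of a constant family. *)
Fixpoint kron_rec k : ('I_k.+1 -> 'M[F]_(m, n)) -> 'M[F]_(m ^ k.+1, n ^ k.+1) :=
  if k is k'.+1 then fun A => A ord0 *t kron_rec (fun i => A (lift ord0 i))
  else fun A => A ord0.

(* A 0 (x) A 1 (x) ... (x) A (k-1).  For columns (n = 1) the result has 1 ^ k
   columns, i.e. one. *)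
Definition kron k : ('I_k -> 'M[F]_(m, n)) -> 'M[F]_(m ^ k, n ^ k) :=
  if k is k'.+1 then @kron_rec k' else fun=> 1.

Lemma kron_const k (A : 'M[F]_(m, n)) : kron (fun _ : 'I_k => A) = A ^t k.
Proof. by case: k => // k; elim: k => //= k ->. Qed.

End Kronecker.

Section Matricization.
Variable n : nat.

(* The column index of the mode-m matricization of an n x ... x n tensor,
   0-based: the factor of i l is the product of the sizes of the modes before l
   other than m, so the first mode other than m varies fastest. *)
Definition mode_col N (m : 'I_N) (i : {ffun 'I_N -> 'I_n}) : nat :=
  (\sum_(l < N | l != m) i l * \prod_(z < N | (z < l) && (z != m)) n)%N.

Lemma mode_colE k (m : 'I_k.+1) (i : {ffun 'I_k.+1 -> 'I_n}) :
  mode_col m i = (\sum_(l < k) i (lift m l) * n ^ l)%N.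
Proof.
rewrite /mode_col big_mkcond (bigD1_ord m) //= eqxx add0n.
apply: eq_bigr => l _; rewrite eq_sym neq_lift; congr (_ * _)%N.
rewrite big_mkcond (bigD1_ord m) //= eqxx andbF mul1n.
transitivity (\prod_(z < k | (z < l)%N) n)%N.
  rewrite [RHS]big_mkcond; apply: eq_bigr => z _.
  rewrite eq_sym neq_lift andbT /= !ltnNge leq_bump2 //.
rewrite -(big_mkord (fun z => z < l)%N (fun=> n)).
rewrite -(big_nat_widen 0 l k xpredT) ?(ltnW (ltn_ord l)) //.
by rewrite prod_nat_const_nat subn0.
Qed.

Lemma mode_col_inj k (m : 'I_k.+1) (i1 i2 : {ffun 'I_k.+1 -> 'I_n}) :
  i1 m = i2 m -> mode_col m i1 = mode_col m i2 -> i1 = i2.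
Proof.
have digits (f g : 'I_k -> 'I_n) :
    (\sum_(l < k) f l * n ^ l = \sum_(l < k) g l * n ^ l)%N -> f =1 g.
  elim: k f g {m i1 i2} => [|k IH] f g; first by move=> _ [].
  have n_gt0 : (0 < n)%N by case: (n) (f ord0) => [[]|].
  have shift (h : 'I_k.+1 -> 'I_n) : (\sum_(l < k.+1) h l * n ^ l =
      (\sum_(l < k) h (lift ord0 l) * n ^ l) * n + h ord0)%N.
    rewrite big_ord_recl muln1 addnC big_distrl; congr (_ + _)%N.
    by apply: eq_bigr => l _; rewrite /= /bump expnSr mulnA.
  rewrite !shift => /eqP; rewrite eq_addl_mul // xpair_eqE.
  case/andP=> /eqP/IH eqS /eqP/val_inj eq0 l.
  by case: (unliftP ord0 l) => [{}l ->|->]; rewrite ?eqS.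
move=> eqm; rewrite !mode_colE => /digits eqs; apply/ffunP => l.
by case: (unliftP m l) => [{}l ->|-> //].
Qed.

Section MatricizeDef.
Variable R : nmodType.

Definition tensor N := {ffun 'I_N -> 'I_n} -> R.

(* The sum has exactly one term: see matricizeE. *)
Definition matricize k (m : 'I_k.+1) (X : tensor k.+1) : 'M[R]_(n, n ^ k) :=
  \matrix_(a, j) \sum_(i : {ffun 'I_k.+1 -> 'I_n}
                      | (i m == a) && (mode_col m i == j)) X i.

Lemma matricizeE k (m : 'I_k.+1) (X : tensor k.+1) i (j : 'I_(n ^ k)) :
  j = mode_col m i :> nat -> matricize m X (i m) j = X i.
Proof.
move=> def_j; rewrite mxE (bigD1 i) ?def_j ?eqxx //= big1 ?addr0 // => i'.
by case/andP=> /andP[/eqP eqm /eqP eqc] /eqP[]; apply: mode_col_inj eqm eqc.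
Qed.

End MatricizeDef.
End Matricization.

(* The data entering the transfer functions; F is the field of the frequencies
   and P the type of the parameters.  Only H xi for 2 <= xi <= d and N eta for
   1 <= eta < d are ever used. *)
Record tfdata (F : fieldType) (P : Type) (n : nat) := TFData {
  tfK : F -> P -> 'M[F]_n;
  tfB : P -> 'cV[F]_n;
  tfC : P -> 'rV[F]_n;
  tfH : forall xi : nat, P -> 'M[F]_(n, n ^ xi);
  tfN : forall eta : nat, P -> 'M[F]_(n, n ^ eta)
}.

Section TransferFunctions.
Variables (F : fieldType) (P : Type) (n : nat) (Sys : tfdata F P n).

Definition tf_v (s : F) (p : P) : 'cV[F]_n := invmx (tfK Sys s p) *m tfB Sys p.

Definition tf_w (s : F) (p : P) : 'cV[F]_n :=
  (invmx (tfK Sys s p))^T *m (tfC Sys p)^T.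

Definition tf_L (s : F) (p : P) : 'M[F]_1 :=
  tfC Sys p *m invmx (tfK Sys s p) *m tfB Sys p.

(* The frequencies s_1, ..., s_(k+1) are s ord0, ..., s ord_max; the Kronecker
   product runs from s_k down to s_1. *)
Definition tf_kron k (s : 'I_k.+1 -> F) (p : P) : 'M[F]_(n ^ k, 1 ^ k) :=
  kron (fun l : 'I_k => tf_v (s (widen_ord (leqnSn k) (rev_ord l))) p).

Definition tf_H xi (s : 'I_xi.+1 -> F) (p : P) : 'M[F]_(1, 1 ^ xi) :=
  tfC Sys p *m invmx (tfK Sys (s ord_max) p) *m tfH Sys xi p *m tf_kron s p.

Definition tf_N eta (s : 'I_eta.+1 -> F) (p : P) : 'M[F]_(1, 1 ^ eta) :=
  tfC Sys p *m invmx (tfK Sys (s ord_max) p) *m tfN Sys eta p *m tf_kron s p.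

Definition petrov_galerkin r (V W : 'M[F]_(n, r)) : tfdata F P r := {|
  tfK := fun s p => W^T *m tfK Sys s p *m V;
  tfB := fun p => W^T *m tfB Sys p;
  tfC := fun p => tfC Sys p *m V;
  tfH := fun xi p => W^T *m tfH Sys xi p *m V ^t xi;
  tfN := fun eta p => W^T *m tfN Sys eta p *m V ^t eta
|}.

End TransferFunctions.
Arguments tf_H {F P n} Sys xi s p.
Arguments tf_N {F P n} Sys eta s p.

(* (s, ..., s, mu) *)
Definition last_freq (F : Type) k (s mu : F) : 'I_k.+1 -> F :=
  fun l => if l == ord_max then mu else s.

(* v (x) ... (x) v (x) w, with k factors; v is absent when k = 1. *)
Definition kron_last (F : pzRingType) n k (v w : 'cV[F]_n) :
    'M[F]_(n ^ k, 1 ^ k) :=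
  kron (fun l : 'I_k => if l.+1 == k then w else v).

Definition mx_range (F : fieldType) m n (A : 'M[F]_(m, n)) : {vspace 'cV[F]_m} :=
  limg (linfun (mulmx A)).

(* A SISO parametric polynomial structured system with n states and q
   parameters.  Frequencies are complex; B, C and the tensors of which H_xi and
   N_eta are the mode-1 matricizations are real. *)
Record polysys (R : realType) (q n : nat) := PolySys {
  sysK : R[i] -> 'rV[R]_q -> 'M[R[i]]_n;
  sysB : 'rV[R]_q -> 'cV[R]_n;
  sysC : 'rV[R]_q -> 'rV[R]_n;
  sysH : forall xi : nat, 'rV[R]_q -> tensor n R xi.+1;
  sysN : forall eta : nat, 'rV[R]_q -> tensor n R eta.+1
}.
Arguments sysH {R q n} _ xi _ _.
Arguments sysN {R q n} _ eta _ _.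

Definition mode1 k : 'I_k.+1 := ord0.
(* The second mode; meaningful for k >= 1 only. *)
Definition mode2 k : 'I_k.+1 := inord 1.

Definition cmx (R : realType) m n (A : 'M[R]_(m, n)) : 'M[R[i]]_(m, n) :=
  map_mx (fun x : R => x%:C) A.

Definition symmetric_mx (R : realType) n k (M : 'M[R]_(n, n ^ k)) : Prop :=
  forall (x : 'I_k -> 'cV[R]_n) (s : 'S_k),
    M *m kron (fun l => x (s l)) = M *m kron x.

Section System.
Variables (R : realType) (q n : nat) (Sys : polysys R q n).

Definition symmetric_sys (Omega : set 'rV[R]_q) (d : nat) : Prop :=
  forall p, Omega p ->
    (forall xi, (2 <= xi <= d)%N ->
       symmetric_mx (matricize (mode1 xi) (sysH Sys xi p))) /\
    (forall eta, (1 <= eta < d)%N ->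
       symmetric_mx (matricize (mode1 eta) (sysN Sys eta p))).

Definition sys_tf : tfdata R[i] 'rV[R]_q n := {|
  tfK := sysK Sys;
  tfB := fun p => cmx (sysB Sys p);
  tfC := fun p => cmx (sysC Sys p);
  tfH := fun xi p => cmx (matricize (mode1 xi) (sysH Sys xi p));
  tfN := fun eta p => cmx (matricize (mode1 eta) (sysN Sys eta p))
|}.

Variables (d rt : nat) (sigma mu : 'I_rt -> R[i]) (pt : 'I_rt -> 'rV[R]_q).

Let v i := tf_v sys_tf (sigma i) (pt i).
Let w i := tf_w sys_tf (mu i) (pt i).
Let Kinv i := invmx (sysK Sys (sigma i) (pt i)).

Definition spaceVL : {vspace 'cV[R[i]]_n} := (\sum_(i < rt) mx_range (v i))%VS.

Definition spaceVN : {vspace 'cV[R[i]]_n} :=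
  (\sum_(1 <= eta < d) \sum_(i < rt)
     mx_range (Kinv i *m tfN sys_tf eta (pt i) *m v i ^t eta))%VS.

Definition spaceVH : {vspace 'cV[R[i]]_n} :=
  (\sum_(2 <= xi < d.+1) \sum_(i < rt)
     mx_range (Kinv i *m tfH sys_tf xi (pt i) *m v i ^t xi))%VS.

Definition spaceWL : {vspace 'cV[R[i]]_n} := (\sum_(i < rt) mx_range (w i))%VS.

Definition spaceWN : {vspace 'cV[R[i]]_n} :=
  (\sum_(1 <= eta < d) \sum_(i < rt)
     mx_range ((Kinv i)^T *m cmx (matricize (mode2 eta) (sysN Sys eta (pt i)))
               *m kron_last eta (v i) (w i)))%VS.

Definition spaceWH : {vspace 'cV[R[i]]_n} :=
  (\sum_(2 <= xi < d.+1) \sum_(i < rt)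
     mx_range ((Kinv i)^T *m cmx (matricize (mode2 xi) (sysH Sys xi (pt i)))
               *m kron_last xi (v i) (w i)))%VS.

End System.

(* Main.v *)
Require Import Defs.
From mathcomp Require Import all_boot all_order all_fingroup all_algebra.
From mathcomp Require Import complex mxtens.
From mathcomp Require Import classical_sets reals.

Set Implicit Arguments.
Unset Strict Implicit.
Unset Printing Implicit Defensive.

Import GRing.Theory.
Local Open Scope ring_scope.
Local Open Scope complex_scope.

(** Petrov-Galerkin projection is exact on whatever its spaces contain.  If the
    solution [X] of [K X = M] has its columns in the range of [V], then [X] is
    [V] times the solution of the projected equation ([galerkin_exact]): the
    two sides solve the same nonsingular reduced system.  Transposing, if
    [K^-T C^T] lies in the range of [W], then the output functional [C K^-1] is
    [(C V) Kr^-1 W^T], where [Kr] is the reduced matrix [W^T K V]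
    ([galerkin_exact_tr]).

    Since the range of [V] contains [v = K(sigma)^-1 B], the reduced state
    [vr] satisfies [V vr = v], hence [V^(k) vr^(k) = v^(k)] for every Kronecker
    power ([ntensmx_mul]), and the forcing terms of the reduced model are the
    projections of those of the full one: [W^T H V^(k) vr^(k) = W^T H v^(k)].
    When the last frequency is [sigma], the vector [K(sigma)^-1 H v^(k)] lies in
    the range of [V] and exactness of the trial space concludes.  When it is
    [mu], the vector [w] lies in the range of [W] and exactness of the test
    space concludes, for any right-hand side.  The linear transfer function is
    the same argument with right-hand side [B].

    The families [H] and [N] have the same shape, so both are instances of
    [reduced_output_trial] and [reduced_output_test], where the tensor is an
    arbitrary matrix. *)

(** A factorization, unlike an inclusion of column spaces, can be substituted
    into a product and cancelled against a nonsingular matrix.  Columns are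
    treated one by one through the row space criterion of the transposes. *)
Lemma mx_range_factor (F : fieldType) n m r (A : 'M[F]_(n, m))
    (V : 'M[F]_(n, r)) :
  (mx_range A <= mx_range V)%VS -> exists Y, A = V *m Y.
Proof.
move=> sAV; suff /submxP[D defA] : (A^T <= V^T)%MS.
  by exists D^T; rewrite -[LHS]trmxK defA trmx_mul trmxK.
apply/row_subP => j; rewrite -tr_col.
have : col j A \in mx_range V.
  apply: (subvP sAV); rewrite colE.
  by rewrite -(lfunE (mulmx A)) memv_img ?memvf.
case/memv_imgP=> y _; rewrite (lfunE (mulmx V)) /= => ->.
by rewrite trmx_mul submxMl.
Qed.

(** Both [Y] such that [invmx K *m M = V *m Y] and the reduced solution solve
    the reduced system with right-hand side [W^T *m M]. *)
Lemma galerkin_exact (F : fieldType) n r m (K : 'M[F]_n) (V W : 'M[F]_(n, r))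
    (M : 'M[F]_(n, m)) :
  K \in unitmx -> W^T *m K *m V \in unitmx ->
  (mx_range (invmx K *m M) <= mx_range V)%VS ->
  V *m (invmx (W^T *m K *m V) *m (W^T *m M)) = invmx K *m M.
Proof.
move=> uK uKr /mx_range_factor[Y defX].
have -> : W^T *m M = W^T *m K *m V *m Y.
  by rewrite -mulmxA -defX -mulmxA mulKVmx.
by rewrite mulKmx // defX.
Qed.

(** Transposition exchanges the trial and test matrices. *)
Lemma galerkin_exact_tr (F : fieldType) n r m (K : 'M[F]_n)
    (V W : 'M[F]_(n, r)) (C : 'M[F]_(m, n)) :
  K \in unitmx -> W^T *m K *m V \in unitmx ->
  (mx_range ((invmx K)^T *m C^T) <= mx_range W)%VS ->
  C *m V *m invmx (W^T *m K *m V) *m W^T = C *m invmx K.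
Proof.
move=> uK uKr sW; apply: trmx_inj.
have defKr : (W^T *m K *m V)^T = V^T *m K^T *m W.
  by rewrite !trmx_mul trmxK mulmxA.
rewrite !trmx_mul trmxK !trmx_inv defKr.
apply: galerkin_exact; rewrite ?unitmx_tr -?defKr ?unitmx_tr //.
by rewrite -trmx_inv.
Qed.

Lemma ntensmx_mul (F : comPzRingType) m n p k (A : 'M[F]_(m, n))
    (B : 'M[F]_(n, p)) : (A ^t k) *m (B ^t k) = (A *m B) ^t k.
Proof.
case: k => [|k]; first exact: mul1mx.
elim: k => [|k IHk]; first by rewrite !ntensmx1.
by rewrite !ntensmxSS -IHk; apply: tensmx_mul.
Qed.

Lemma eq_kron (F : pzRingType) m n k (A B : 'I_k -> 'M[F]_(m, n)) :
  A =1 B -> kron A = kron B.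
Proof.
case: k A B => [//|k]; elim: k => [|k IHk] A B eqAB /=; first exact: eqAB.
congr (_ *t _); first exact: eqAB.
by apply: (IHk (fun i => A (lift ord0 i))) => i; apply: eqAB.
Qed.

(** The last frequency enters a transfer function only through the output
    functional, so the Kronecker product is a power both for [(s0, ..., s0)] and
    for [(s0, ..., s0, mu)]. *)
Lemma tf_kron_const (F : fieldType) (P : Type) n (Sys : tfdata F P n) k
    (s : 'I_k.+1 -> F) s0 p :
  (forall l, l != ord_max -> s l = s0) ->
  tf_kron Sys s p = tf_v Sys s0 p ^t k.
Proof.
move=> s_s0; rewrite -kron_const; apply: eq_kron => l; rewrite s_s0 //.
by rewrite -val_eqE /= ltn_eqF // subnSK // leq_subr.
Qed.

Section ReducedOutput.
Variables (F : fieldType) (P : Type) (n r : nat) (Sys : tfdata F P n).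
Variables (V W : 'M[F]_(n, r)) (p : P).

Let Red := petrov_galerkin Sys V W.

Lemma reduced_state s :
  tfK Sys s p \in unitmx -> tfK Red s p \in unitmx ->
  (mx_range (tf_v Sys s p) <= mx_range V)%VS ->
  V *m tf_v Red s p = tf_v Sys s p.
Proof. exact: galerkin_exact. Qed.

(** The reduced tensor sees the reduced state only through [V], so that state
    can be replaced by the full one. *)
Lemma reduced_output_state k s (M : 'M[F]_(n, n ^ k)) (v : 'cV[F]_n) vr :
  V *m vr = v ->
  tfC Red p *m invmx (tfK Red s p) *m (W^T *m M *m V ^t k) *m vr ^t k
  = tfC Red p *m invmx (tfK Red s p) *m (W^T *m (M *m v ^t k)).
Proof. by move=> <-; rewrite -ntensmx_mul !mulmxA. Qed.

Lemma reduced_output_trial k s (M : 'M[F]_(n, n ^ k)) (v : 'cV[F]_n) vr :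
  tfK Sys s p \in unitmx -> tfK Red s p \in unitmx ->
  V *m vr = v ->
  (mx_range (invmx (tfK Sys s p) *m M *m v ^t k) <= mx_range V)%VS ->
  tfC Sys p *m invmx (tfK Sys s p) *m M *m v ^t k
  = tfC Red p *m invmx (tfK Red s p) *m (W^T *m M *m V ^t k) *m vr ^t k.
Proof.
move=> uK uKr defv sV; rewrite (reduced_output_state _ _ defv).
rewrite -mulmxA in sV.
by rewrite -!mulmxA -(galerkin_exact uK uKr sV).
Qed.

Lemma reduced_functional s :
  tfK Sys s p \in unitmx -> tfK Red s p \in unitmx ->
  (mx_range (tf_w Sys s p) <= mx_range W)%VS ->
  tfC Red p *m invmx (tfK Red s p) *m W^T = tfC Sys p *m invmx (tfK Sys s p).
Proof. exact: galerkin_exact_tr. Qed.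

Lemma reduced_output_test k s (M : 'M[F]_(n, n ^ k)) (v : 'cV[F]_n) vr :
  tfK Sys s p \in unitmx -> tfK Red s p \in unitmx ->
  V *m vr = v ->
  (mx_range (tf_w Sys s p) <= mx_range W)%VS ->
  tfC Sys p *m invmx (tfK Sys s p) *m M *m v ^t k
  = tfC Red p *m invmx (tfK Red s p) *m (W^T *m M *m V ^t k) *m vr ^t k.
Proof.
move=> uK uKr defv sW; rewrite (reduced_output_state _ _ defv).
by rewrite mulmxA (reduced_functional uK uKr sW) !mulmxA.
Qed.

End ReducedOutput.

Lemma last_freq_max (T : Type) k (s mu : T) :
  last_freq s mu (ord_max : 'I_k.+1) = mu.
Proof. by rewrite /last_freq eqxx. Qed.

Lemma last_freq_neq (T : Type) k (s mu : T) (l : 'I_k.+1) :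
  l != ord_max -> last_freq s mu l = s.
Proof. by rewrite /last_freq => /negPf->. Qed.

Lemma sumv_nat_sup (K : fieldType) (vT : vectType K) a b k
    (f : nat -> {vspace vT}) :
  (a <= k < b)%N -> (f k <= \sum_(a <= j < b) f j)%VS.
Proof.
move=> abk; rewrite (big_rem k) ?mem_index_iota //=; exact: addvSl.
Qed.

Theorem theorem3 (R : realType) (q n r d rt : nat) (Omega : set 'rV[R]_q)
    (Sys : polysys R q n) (hsym : symmetric_sys Sys Omega d)
    (sigma mu : 'I_rt -> R[i]) (pt : 'I_rt -> 'rV[R]_q)
    (hpt : forall i, Omega (pt i))
    (hK : forall i j, sysK Sys (sigma i) (pt j) \in unitmx
                   /\ sysK Sys (mu i) (pt j) \in unitmx)
    (V W : 'M[R[i]]_(n, r))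
    (hVrank : \rank V = r) (hWrank : \rank W = r)
    (hV : mx_range V = (spaceVL Sys sigma pt + spaceVN Sys d sigma pt
                        + spaceVH Sys d sigma pt)%VS)
    (hW : mx_range W = (spaceWL Sys mu pt + spaceWN Sys d sigma mu pt
                        + spaceWH Sys d sigma mu pt)%VS)
    (hred : forall i, W^T *m sysK Sys (sigma i) (pt i) *m V \in unitmx
                   /\ W^T *m sysK Sys (mu i) (pt i) *m V \in unitmx) :
  let F := sys_tf Sys in
  let Fhat := petrov_galerkin F V W in
  forall i : 'I_rt,
    [/\ tf_L F (sigma i) (pt i) = tf_L Fhat (sigma i) (pt i),
        tf_L F (mu i) (pt i) = tf_L Fhat (mu i) (pt i),
        forall eta : nat, (1 <= eta < d)%N ->
          tf_N F eta (fun=> sigma i) (pt i)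
          = tf_N Fhat eta (fun=> sigma i) (pt i)
          /\ tf_N F eta (last_freq (sigma i) (mu i)) (pt i)
             = tf_N Fhat eta (last_freq (sigma i) (mu i)) (pt i)
      & forall xi : nat, (2 <= xi <= d)%N ->
          tf_H F xi (fun=> sigma i) (pt i)
          = tf_H Fhat xi (fun=> sigma i) (pt i)
          /\ tf_H F xi (last_freq (sigma i) (mu i)) (pt i)
             = tf_H Fhat xi (last_freq (sigma i) (mu i)) (pt i)].
Proof.
move=> F Fhat i.
have [uKs uKm] : tfK F (sigma i) (pt i) \in unitmx
              /\ tfK F (mu i) (pt i) \in unitmx := hK i i.
have [uRs uRm] : tfK Fhat (sigma i) (pt i) \in unitmx
              /\ tfK Fhat (mu i) (pt i) \in unitmx := hred i.
have sVL : (mx_range (tf_v F (sigma i) (pt i)) <= mx_range V)%VS.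
  rewrite hV; apply: (subv_trans _ (subv_trans (addvSl _ _) (addvSl _ _))).
  exact: (sumv_sup i).
have sVN eta : (1 <= eta < d)%N ->
    (mx_range (invmx (tfK F (sigma i) (pt i)) *m tfN F eta (pt i)
               *m tf_v F (sigma i) (pt i) ^t eta) <= mx_range V)%VS.
  move=> heta; rewrite hV.
  apply: (subv_trans _ (subv_trans (addvSr _ _) (addvSl _ _))).
  apply: (subv_trans _ (sumv_nat_sup _ heta)); exact: (sumv_sup i).
have sVH xi : (2 <= xi <= d)%N ->
    (mx_range (invmx (tfK F (sigma i) (pt i)) *m tfH F xi (pt i)
               *m tf_v F (sigma i) (pt i) ^t xi) <= mx_range V)%VS.
  move=> hxi; rewrite hV; apply: (subv_trans _ (addvSr _ _)).
  apply: (subv_trans _ (sumv_nat_sup (b := d.+1) _ hxi)); exact: (sumv_sup i).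
have sWL : (mx_range (tf_w F (mu i) (pt i)) <= mx_range W)%VS.
  rewrite hW; apply: (subv_trans _ (subv_trans (addvSl _ _) (addvSl _ _))).
  exact: (sumv_sup i).
have defv := reduced_state uKs uRs sVL.
split=> [||eta heta|xi hxi].
- by rewrite /tf_L -!mulmxA -/(tf_v F _ _) -/(tf_v Fhat _ _) -defv.
- rewrite [RHS]mulmxA.
  by rewrite (reduced_functional uKm uRm sWL).
- split; rewrite /tf_N.
  + rewrite !(tf_kron_const _ _ (s0 := sigma i)) //.
    exact: reduced_output_trial (sVN _ heta).
  + rewrite !(tf_kron_const _ _ (s0 := sigma i)) ?last_freq_max;
      try exact: last_freq_neq.
    exact: reduced_output_test.
- split; rewrite /tf_H.
  + rewrite !(tf_kron_const _ _ (s0 := sigma i)) //.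
    exact: reduced_output_trial (sVH _ hxi).
  + rewrite !(tf_kron_const _ _ (s0 := sigma i)) ?last_freq_max;
      try exact: last_freq_neq.
    exact: reduced_output_test.
Qed.
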